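(* Let $s\geq 4$ be an even integer and let $t\geq 3$ be an integer with $t \not\equiv 2, 4, 6, \dots, s-2 \pmod{s}$. Then \[ \sum_{n\geq 0} E_{s}^{t}(n)q^{n} = \frac{(q^{2};q^{2})_{\infty} (q^{t};q^{t})_{\infty} (q^{ts};q^{ts})_{\infty}}{(q;q)_{\infty} (q^{s};q^{s})_{\infty} (q^{2t};q^{2t})_{\infty}}. \]
   Context: $E_{s}^{t}(n)$ is the number of partitions of $n$ into parts that are not congruent to any of $2,4,6,\dots,s-2$ modulo $s$ and not congruent to any of $0$ and $t(2r+1)$, $r=0,1,\dots,s/2-1$, modulo $ts$. Notation: $(a;q)_{\infty}=\prod_{i\geq 0}(1-aq^{i})$. *)

(* Defs.v *)
From HB Require Import structures.
From mathcomp Require Import all_boot all_order all_algebra.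
From mathcomp Require Import boolp classical_sets.

Set Implicit Arguments.
Unset Strict Implicit.
Unset Printing Implicit Defensive.

Import GRing.Theory.
Local Open Scope ring_scope.

(* The ring R[[q]] of formal power series. A record rather than a bare        *)
(* [nat -> R], so that its Cauchy product does not clash with the pointwise   *)
(* product of functions.                                                      *)
Record fps (R : Type) := Fps { fcoef : nat -> R }.

Lemma fpsP (R : Type) (f g : fps R) : fcoef f =1 fcoef g <-> f = g.
Proof. by case: f g => [f] [g]; split=> [/funext /= ->|->]. Qed.

HB.instance Definition _ (R : Type) := gen_eqMixin (fps R).
HB.instance Definition _ (R : Type) := gen_choiceMixin (fps R).

Section FpsRing.
Variable R : comNzRingType.
Implicit Types f g h : fps R.

Definition fps_zero : fps R := Fps (fun=> 0).
Definition fps_opp f := Fps (fun n => - fcoef f n).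
Definition fps_add f g := Fps (fun n => fcoef f n + fcoef g n).

Fact fps_addA : associative fps_add.
Proof. by move=> f g h; apply/fpsP => n; exact: addrA. Qed.
Fact fps_addC : commutative fps_add.
Proof. by move=> f g; apply/fpsP => n; exact: addrC. Qed.
Fact fps_add0 : left_id fps_zero fps_add.
Proof. by move=> f; apply/fpsP => n; exact: add0r. Qed.
Fact fps_addN : left_inverse fps_zero fps_opp fps_add.
Proof. by move=> f; apply/fpsP => n; exact: addNr. Qed.

HB.instance Definition _ :=
  GRing.isZmodule.Build (fps R) fps_addA fps_addC fps_add0 fps_addN.

Definition fps_one : fps R := Fps (fun n => (n == 0%N)%:R).
Definition fps_mul f g :=
  Fps (fun n => \sum_(i < n.+1) fcoef f i * fcoef g (n - i)).

Definition fps_trunc N f : {poly R} := \poly_(i < N.+1) fcoef f i.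

Lemma coef_fps_trunc N f i : (i <= N)%N -> (fps_trunc N f)`_i = fcoef f i.
Proof. by move=> iN; rewrite coef_poly ltnS iN. Qed.

Lemma coef_mul_trunc N (p p' r r' : {poly R}) :
    (forall i, (i <= N)%N -> p`_i = p'`_i) ->
    (forall i, (i <= N)%N -> r`_i = r'`_i) ->
  (p * r)`_N = (p' * r')`_N.
Proof.
move=> Hp Hr; rewrite !coefM; apply: eq_bigr => i _.
by rewrite Hp -1?ltnS // Hr // leq_subr.
Qed.

Lemma fcoef_mul_trunc N f g i : (i <= N)%N ->
  fcoef (fps_mul f g) i = (fps_trunc N f * fps_trunc N g)`_i.
Proof.
move=> iN; rewrite coefM /=; apply: eq_bigr => j _.
rewrite !coef_fps_trunc ?(leq_trans _ iN) ?leq_subr //.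
by rewrite -ltnS.
Qed.

Fact fps_mulA : associative fps_mul.
Proof.
move=> f g h; apply/fpsP => n; rewrite !(@fcoef_mul_trunc n) //.
transitivity ((fps_trunc n f * (fps_trunc n g * fps_trunc n h))`_n).
  apply: coef_mul_trunc => // i le_in.
  by rewrite coef_fps_trunc // (fcoef_mul_trunc _ _ le_in).
rewrite mulrA; apply: coef_mul_trunc => // i le_in.
by rewrite coef_fps_trunc // (fcoef_mul_trunc _ _ le_in).
Qed.

Fact fps_mulC : commutative fps_mul.
Proof.
by move=> f g; apply/fpsP => n; rewrite !(@fcoef_mul_trunc n) // mulrC.
Qed.

Fact fps_mul1 : left_id fps_one fps_mul.
Proof.
move=> f; apply/fpsP => n /=; rewrite big_ord_recl /= mul1r subn0.
by rewrite big1 ?addr0 // => i _; rewrite mul0r.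
Qed.

Fact fps_mulDl : left_distributive fps_mul fps_add.
Proof.
move=> f g h; apply/fpsP => n /=; rewrite -big_split /=.
by apply: eq_bigr => i _; rewrite mulrDl.
Qed.

Fact fps_oner_neq0 : fps_one != 0.
Proof.
by apply/eqP => /(congr1 (fun f => fcoef f 0)) /eqP /=; rewrite oner_eq0.
Qed.

HB.instance Definition _ := GRing.Zmodule_isComNzRing.Build (fps R)
  fps_mulA fps_mulC fps_mul1 fps_mulDl fps_oner_neq0.

Definition fpsX : fps R := Fps (fun n => (n == 1%N)%:R).

Lemma fcoef0 n : fcoef (0 : fps R) n = 0. Proof. by []. Qed.
Lemma fcoef1 n : fcoef (1 : fps R) n = (n == 0%N)%:R. Proof. by []. Qed.
Lemma fcoefX n : fcoef fpsX n = (n == 1%N)%:R. Proof. by []. Qed.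
Lemma fcoefN f n : fcoef (- f) n = - fcoef f n. Proof. by []. Qed.
Lemma fcoefD f g n : fcoef (f + g) n = fcoef f n + fcoef g n.
Proof. by []. Qed.
Lemma fcoefB f g n : fcoef (f - g) n = fcoef f n - fcoef g n.
Proof. by []. Qed.
Lemma fcoefM f g n :
  fcoef (f * g) n = \sum_(i < n.+1) fcoef f i * fcoef g (n - i).
Proof. by []. Qed.

Lemma fcoef_sum (I : Type) (r : seq I) (P : pred I) (F : I -> fps R) n :
  fcoef (\sum_(i <- r | P i) F i) n = \sum_(i <- r | P i) fcoef (F i) n.
Proof. by apply: (big_morph (fun f => fcoef f n)). Qed.

Lemma fcoef_exp_small h k n : fcoef h 0 = 0 -> (n < k)%N ->
  fcoef (h ^+ k) n = 0.
Proof.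
move=> h0; elim: k n => // k IHk n; rewrite ltnS => le_nk.
rewrite exprS fcoefM big1 // => -[[|i] /= lt_in] _; first by rewrite h0 mul0r.
rewrite IHk ?mulr0 // (leq_trans _ le_nk) // ltn_subrL /=.
by case: n lt_in {le_nk}.
Qed.

(* Coefficientwise (q-adic) convergence: every coefficient is eventually      *)
(* constant. [fps_lim u] is a junk value when [u] does not converge.          *)
Definition fps_cvg_to (u : nat -> fps R) (l : fps R) : Prop :=
  forall n, exists N, forall m, (N <= m)%N -> fcoef (u m) n = fcoef l n.

Definition fps_lim (u : nat -> fps R) : fps R :=
  xget 0 [set l | fps_cvg_to u l]%classic.

Lemma fps_cvg_unique u l l' : fps_cvg_to u l -> fps_cvg_to u l' -> l = l'.
Proof.
move=> ul ul'; apply/fpsP => n; have [N HN] := ul n; have [N' HN'] := ul' n.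
by rewrite -(HN (maxn N N')) ?leq_maxl // HN' // leq_maxr.
Qed.

Lemma fps_limE u l : fps_cvg_to u l -> fps_lim u = l.
Proof.
move=> ul; rewrite /fps_lim; case: xgetP => [l' _ /= ul'|/(_ l)//].
exact: fps_cvg_unique ul' ul.
Qed.

(* (a; q)_oo = \prod_(i >= 0) (1 - a q^i) *)
Definition qpoch (a q : fps R) : fps R :=
  fps_lim (fun N => \prod_(i < N) (1 - a * q ^+ i)).

Lemma qpoch_cvg (a q : fps R) : fcoef q 0 = 0 ->
  fps_cvg_to (fun N => \prod_(i < N) (1 - a * q ^+ i)) (qpoch a q).
Proof.
move=> q0; pose u N := \prod_(i < N) (1 - a * q ^+ i).
have uS N : u N.+1 = u N * (1 - a * q ^+ N) by rewrite /u big_ord_recr.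
suff ul : fps_cvg_to u (Fps (fun n => fcoef (u n.+1) n)).
  by rewrite /qpoch (fps_limE ul).
move=> n; exists n.+1 => m /subnK <-; elim: (m - _)%N => // k IHk.
rewrite addSn uS mulrBr mulr1 fcoefB IHk.
rewrite mulrA fcoefM big1 ?subr0 // => i _.
by rewrite fcoef_exp_small ?mulr0 // (leq_ltn_trans (leq_subr _ _)) // leq_addl.
Qed.

End FpsRing.

Section FpsUnitRing.
Variable R : comUnitRingType.
Implicit Types f g h : fps R.

Definition fpsC (c : R) : fps R := Fps (fun n => if n == 0%N then c else 0).

Definition fps_unit : {pred fps R} := fun f => fcoef f 0 \is a GRing.unit.

(* 1/f = c \sum_(k >= 0) (1 - c f)^k with c = 1/f(0), the terms k > n not     *)
(* contributing to the coefficient of q^n.                                    *)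
Definition fps_inv f : fps R :=
  if f \in fps_unit then
    let c := fpsC (fcoef f 0)^-1 in
    Fps (fun n => fcoef (c * \sum_(k < n.+1) (1 - c * f) ^+ k) n)
  else f.

Fact fps_mulVr : {in fps_unit, left_inverse 1 fps_inv *%R}.
Proof.
move=> f fU; rewrite /fps_inv fU; set c := fpsC _; set h := 1 - c * f.
have h0 : fcoef h 0 = 0.
  rewrite fcoefB fcoefM big_ord_recl big_ord0 addr0 /= mulVr ?subrr //.
have stab N n : (n <= N)%N -> fcoef (c * \sum_(k < n.+1) h ^+ k) n
                              = fcoef (c * \sum_(k < N.+1) h ^+ k) n.
  move=> /subnK <-; elim: (N - n)%N => // k ->.
  have -> : \sum_(j < (k.+1 + n).+1) h ^+ j
            = \sum_(j < (k + n).+1) h ^+ j + h ^+ (k + n).+1.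
    by rewrite addSn big_ord_recr.
  rewrite mulrDr fcoefD.
  rewrite [X in _ = _ + X]fcoefM [X in _ = _ + X]big1 ?addr0 // => i _.
  by rewrite fcoef_exp_small ?mulr0 // (leq_ltn_trans (leq_subr _ _)) // ltnS leq_addl.
apply/fpsP => n.
transitivity (fcoef ((c * \sum_(k < n.+1) h ^+ k) * f) n).
  rewrite !fcoefM; apply: eq_bigr => i _; congr (_ * _).
  by apply: stab; rewrite -ltnS.
rewrite mulrAC [c * f](_ : _ = 1 - h); last by rewrite opprB addrC subrK.
have -> : (1 - h) * \sum_(k < n.+1) h ^+ k = 1 - h ^+ n.+1.
  by rewrite -[RHS]opprB subrX1 -mulNr [- (h - 1)]opprB.
by rewrite fcoefB fcoef_exp_small // subr0.
Qed.

Fact fps_unitPl f g : g * f = 1 -> f \in fps_unit.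
Proof.
move=> /(congr1 (fun h => fcoef h 0)).
rewrite fcoefM big_ord_recl big_ord0 addr0 fcoef1 /= => gf1.
by apply/unitrP; exists (fcoef g 0); split=> //; rewrite mulrC.
Qed.

Fact fps_inv_out : {in [predC fps_unit], fps_inv =1 id}.
Proof. by move=> f /negbTE fU; rewrite /fps_inv fU. Qed.

HB.instance Definition _ := GRing.ComNzRing_hasMulInverse.Build (fps R)
  fps_mulVr fps_unitPl fps_inv_out.

End FpsUnitRing.

(* m is congruent to one of 2, 4, ..., s - 2 modulo s (s even) *)
Definition nz_even_residue (s m : nat) : bool :=
  [exists j : 'I_s./2, (0 < j)%N && (m == 2 * j %[mod s])%N].

Definition E_part (s t m : nat) : bool :=
  [&& ~~ nz_even_residue s m,
      (m != 0 %[mod t * s])%N &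
      [forall r : 'I_s./2, m != t * (2 * r + 1) %[mod t * s]]%N].

(* Partitions as nonincreasing sequences of positive parts. A partition of n  *)
(* has at most n parts, each at most n, so the type n.-bseq 'I_n.+1 of        *)
(* sequences of length at most n with entries at most n misses none of them.  *)
Definition is_partition (n : nat) (p : seq nat) : bool :=
  [&& sorted geq p, all (leq 1) p & sumn p == n].

Lemma partition_bseq (n : nat) (p : seq nat) : is_partition n p ->
  exists b : n.-bseq 'I_n.+1, [seq val i | i <- b] = p.
Proof.
case/and3P=> _ p_pos /eqP p_n.
have size_p : (size p <= n)%N.
  rewrite -{}p_n; elim: p p_pos => //= x p IHp /andP[x_pos /IHp].
  by rewrite -add1n; apply: leq_add.
have mem_p : {in p, forall x, x < n.+1}%N.
  rewrite -p_n => x; elim: {p_pos p_n size_p} p => //= y p IHp.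
  rewrite inE ltnS => /predU1P[->|/IHp]; first exact: leq_addr.
  by rewrite ltnS => /leq_trans; apply; apply: leq_addl.
have size_b : (size [seq (inord x : 'I_n.+1) | x <- p] <= n)%N.
  by rewrite size_map.
exists (Bseq size_b) => /=; rewrite -map_comp -[RHS]map_id.
by apply/eq_in_map => x /mem_p; exact: inordK.
Qed.

Definition E (s t n : nat) : nat :=
  #|[set p : n.-bseq 'I_n.+1 |
      let parts := [seq val i | i <- p] in
      is_partition n parts && all (E_part s t) parts]|.

(* Main.v *)
Require Import Defs.
From mathcomp Require Import all_boot all_order all_algebra.
From mathcomp Require Import zify.

(** Both sides are handled through the products [\prod_(m >= 1 | P m) (1 - q^m)].
Euler's argument shows that the series counting the partitions with parts in
[P] is the inverse of that product, and each Pochhammer symbol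
[(q^k; q^k)_oo] is the product over the multiples of [k].  It then remains to
compare, for every [m], the exponents of [1 - q^m]: the admissible parts are
[A \ B] with [A = {m odd or s | m}] and [B = {t j : j odd or s | j}], the
condition on [t] says exactly that [B] is contained in [A], and the indicator
of [{m odd or s | m}] is [1 + [s | m] - [2 | m]]. *)

Set Implicit Arguments.
Unset Strict Implicit.
Unset Printing Implicit Defensive.

Import GRing.Theory.
Local Open Scope ring_scope.

(** * Convergence of products, and infinite products over a set of exponents *)

Section PowerSeries.
Variable R : comNzRingType.
Implicit Types f g : fps R.

Lemma fcoef_mulX f n : fcoef (fpsX R * f) n = if n is n'.+1 then fcoef f n' else 0.
Proof.
rewrite fcoefM; case: n => [|n].
  by rewrite big_ord_recl big_ord0 fcoefX mul0r addr0.
rewrite 2!big_ord_recl !fcoefX mul0r mul1r add0r big1 ?addr0 /= ?subSS ?subn0 //.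
by move=> i _; rewrite mul0r.
Qed.

Lemma fcoef_mulXn k f n :
  fcoef (fpsX R ^+ k * f) n = if (k <= n)%N then fcoef f (n - k) else 0.
Proof.
elim: k n => [|k IHk] n; first by rewrite expr0 mul1r subn0.
by rewrite exprS -mulrA fcoef_mulX; case: n => // n; rewrite IHk ltnS subSS.
Qed.

(** Coefficient [n] of a product involves only coefficients of index at most [n], so finitely many
    thresholds matter and their maximum works. *)
Lemma fps_cvg_mul (u v : nat -> fps R) f g :
  fps_cvg_to u f -> fps_cvg_to v g -> fps_cvg_to (fun N => u N * v N) (f * g).
Proof.
move=> uf vg n.
have unif (w : nat -> fps R) h : fps_cvg_to w h -> exists N, forall m i,
    (N <= m)%N -> (i <= n)%N -> fcoef (w m) i = fcoef h i.
  move=> wh; elim: n => [|n [N HN]].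
    by have [N HN] := wh 0%N; exists N => m [|i] // /HN.
  have [N' HN'] := wh n.+1; exists (maxn N N') => m i.
  rewrite geq_max => /andP[Nm N'm]; rewrite leq_eqVlt => /predU1P[->|].
    exact: HN'.
  by rewrite ltnS; exact: HN.
have [N HN] := unif _ _ uf; have [N' HN'] := unif _ _ vg.
exists (maxn N N') => m; rewrite geq_max => /andP[Nm N'm].
rewrite !fcoefM; apply: eq_bigr => i _.
by rewrite HN -1?ltnS // HN' // leq_subr.
Qed.

Lemma fps_cvg_const f : fps_cvg_to (fun=> f) f.
Proof. by move=> n; exists 0%N. Qed.

Definition euler_partial (P : pred nat) (N : nat) : fps R :=
  \prod_(i < N | P i.+1) (1 - fpsX R ^+ i.+1).

(** The diagonal yields the infinite product: factors with exponent above [n] leave coefficient [n]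
    unchanged. *)
Definition euler_prod (P : pred nat) : fps R :=
  Fps (fun n => fcoef (euler_partial P n) n).

Lemma euler_partialS P N : euler_partial P N.+1 =
  euler_partial P N * (1 - fpsX R ^+ N.+1) ^+ P N.+1.
Proof.
rewrite /euler_partial big_mkcond big_ord_recr /= -big_mkcond.
by case: (P _); rewrite ?expr1 ?expr0.
Qed.

Lemma euler_prod_cvg P : fps_cvg_to (euler_partial P) (euler_prod P).
Proof.
move=> n; exists n => m /subnK <-; elim: (m - n)%N => // k IHk.
rewrite addSn euler_partialS; case: (P _); last by rewrite mulr1.
rewrite expr1 mulrBr mulr1 fcoefB IHk mulrC fcoef_mulXn.
by rewrite ltnNge leq_addl subr0.
Qed.

Lemma qpoch_euler_prod k : (0 < k)%N ->
  qpoch (fpsX R ^+ k) (fpsX R ^+ k) = euler_prod (dvdn k).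
Proof.
move=> k_gt0; apply: fps_limE => n.
have [N HN] := euler_prod_cvg (dvdn k) n; exists N => m Nm.
(* The first [m] factors of the Pochhammer symbol form the partial product up to exponent [k * m],
   which is past the threshold since [k] is positive. *)
rewrite -(HN (k * m)%N); last by apply: leq_trans Nm _; rewrite leq_pmull.
congr (fcoef _ _); elim: m {Nm} => [|m IHm].
  by rewrite muln0 /euler_partial !big_ord0.
rewrite big_ord_recr /= IHm -exprS -exprM mulnS addnC.
(* Between two consecutive multiples of [k] the partial product is constant. *)
have step j : (j < k)%N ->
    euler_partial (dvdn k) (k * m + j) = euler_partial (dvdn k) (k * m).
  elim: j => [|j IHj] jk; first by rewrite addn0.
  rewrite addnS euler_partialS IHj 1?ltnW // -addnS dvdn_addr ?dvdn_mulr //.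
  by rewrite gtnNdvd // mulr1.
rewrite -[X in euler_partial _ (_ + X)](prednK k_gt0) addnS euler_partialS.
by rewrite step ?prednK // -addnS prednK // dvdn_addr ?dvdn_mulr // dvdnn expr1.
Qed.

End PowerSeries.

(** * Euler's argument, by induction on a bound for the largest part *)

Section PartitionSeries.
Variable P : pred nat.

Definition num_partitions (n : nat) : nat :=
  #|[set p : n.-bseq 'I_n.+1 |
      let parts := [seq val i | i <- p] in
      is_partition n parts && all P parts]|.

Definition bounded_partition (k n : nat) (p : seq nat) : bool :=
  [&& path geq k p, all (fun x => (0 < x)%N && P x) p & sumn p == n].

(* The partitions satisfying [bounded_partition k n], provided that the fuel  *)
(* [d] is at least [k + n].                                                   *)
Fixpoint partitions (d k n : nat) : seq (seq nat) :=
  if d is d'.+1 then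
    if k is k'.+1 then
      partitions d' k' n ++
      (if P k && (k <= n)%N then [seq k :: p | p <- partitions d' k (n - k)]
       else [::])
    else if n == 0%N then [:: [::]] else [::]
  else if n == 0%N then [:: [::]] else [::].

Lemma bounded_partition0 n p :
  bounded_partition 0 n p = (p \in if n == 0%N then [:: [::]] else [::]).
Proof.
rewrite /bounded_partition eq_sym; case: p => [|x p] /=; first by case: n.
by case: (n == 0%N); case: x => [|x]; rewrite ?inE /= ?andbF.
Qed.

Lemma mem_partitions d k n p : (k + n <= d)%N ->
  (p \in partitions d k n) = bounded_partition k n p.
Proof.
elim: d k n p => [|d IHd] [|k] n p //= kn; rewrite ?bounded_partition0 //.
rewrite mem_cat IHd; last by lia.
case: p => [|x p].
  rewrite /bounded_partition /=; case: ifP => _; last by rewrite orbF.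
  by rewrite [_ \in map _ _](_ : _ = false) ?orbF //; apply/mapP => -[].
have -> : (x :: p \in if P k.+1 && (k < n)%N
            then [seq k.+1 :: q | q <- partitions d k.+1 (n - k.+1)] else [::])
          = [&& x == k.+1, P k.+1, (k < n)%N & bounded_partition k.+1 (n - k.+1) p].
  case: ifP => [/andP[-> kn']|nP].
    rewrite kn' /=; apply/mapP/andP => [[q qin [-> ->]]|[/eqP -> pin]].
      by rewrite eqxx -IHd //; lia.
    by exists p => //; rewrite IHd //; lia.
  by rewrite in_nil [P _ && _]andbA nP andbF.
rewrite /bounded_partition /=.
(* A list with head [k.+1] can only come from the second half of the enumeration, any other nonempty
   list only from the first. *)
have [->|neq] := eqVneq x k.+1.
  rewrite ltnn leqnn /= -!andbA; case: (P _) => //=; rewrite ?andbF //.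
  case: (path _ _ _); case: (all _ _); rewrite ?andbF //=; lia.
by rewrite orbF [in RHS]leq_eqVlt (negbTE neq) ltnS.
Qed.

Lemma uniq_partitions d k n : (k + n <= d)%N -> uniq (partitions d k n).
Proof.
elim: d k n => [|d IHd] [|k] n //= kn; try by case: (n == 0%N).
rewrite cat_uniq IHd /=; last by lia.
case: ifP => [/andP[_ kn']|_] //=.
rewrite map_inj_uniq ?IHd ?andbT; last by move=> ? ? [].
  apply/hasPn => _ /mapP[p _ ->]; rewrite mem_partitions; last by lia.
  by rewrite /bounded_partition /= ltnn.
by lia.
Qed.

Definition num_bounded (k n : nat) := size (partitions (k + n) k n).

Lemma size_partitions d k n : (k + n <= d)%N ->
  size (partitions d k n) = num_bounded k n.
Proof.
move=> kn; apply/perm_size/uniq_perm; rewrite ?uniq_partitions // => p.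
by rewrite !mem_partitions.
Qed.

Lemma num_boundedS k n : num_bounded k.+1 n =
  (num_bounded k n +
   if P k.+1 && (k.+1 <= n)%N then num_bounded k.+1 (n - k.+1) else 0)%N.
Proof.
rewrite {1}/num_bounded addSn /= size_cat; congr (_ + _)%N.
by case: ifP => // /andP[_ kn]; rewrite size_map size_partitions //; lia.
Qed.

(** The largest part never exceeds the sum [n], so the bound [k] is automatic. *)
Lemma bounded_partition_large k n p : (n <= k)%N ->
  bounded_partition k n p = is_partition n p && all P p.
Proof.
move=> nk; rewrite /bounded_partition /is_partition all_predI.
have [pn|] := eqVneq (sumn p) n; last by rewrite !andbF.
have -> : path geq k p = sorted geq p.
  case: p pn => //= x p pn.
  by rewrite (leq_trans _ nk) // -pn leq_addr.
by rewrite !andbT andbA.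
Qed.

Lemma num_bounded_large k n : (n <= k)%N -> num_bounded k n = num_partitions n.
Proof.
move=> nk; rewrite /num_partitions cardE -(size_map (fun b : n.-bseq _ =>
  [seq val i | i <- b])); apply/perm_size/uniq_perm.
- exact: uniq_partitions.
- rewrite map_inj_uniq ?enum_uniq // => b c /(inj_map val_inj) bc.
  exact: val_inj.
move=> p; rewrite mem_partitions // bounded_partition_large //.
apply/idP/mapP => [Hp|[b]]; last by rewrite mem_enum inE => Hb ->.
have /andP[/partition_bseq[b bp] _] := Hp.
by exists b => //; rewrite mem_enum inE bp.
Qed.

(** By [num_boundedS], if [k.+1] satisfies [P] then multiplying the series for [k.+1] by
    [1 - q^(k+1)] gives the series for [k]; otherwise the two series agree. *)
Lemma num_bounded_series (R : comNzRingType) k :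
  Fps (fun n => (num_bounded k n)%:R) * euler_partial R P k = 1.
Proof.
elim: k => [|k IHk].
  rewrite /euler_partial big_ord0 mulr1; apply/fpsP => n /=.
  by rewrite /num_bounded; case: n.
rewrite euler_partialS mulrCA mulrC -[RHS]IHk; congr (_ * _).
rewrite mulrC; apply/fpsP => n; case Pk: (P k.+1).
  rewrite expr1 mulrBl mul1r fcoefB fcoef_mulXn /= num_boundedS Pk /=.
  by case: ifP => _; rewrite natrD ?addrK // mulr0n addr0 subr0.
by rewrite expr0 mul1r /= num_boundedS Pk addn0.
Qed.

Lemma num_partitions_series (R : comNzRingType) :
  Fps (fun n => (num_partitions n)%:R) * euler_prod R P = 1.
Proof.
(* The bounded identities say that a sequence converging to the left side is constantly 1. *)
apply: (fps_cvg_unique _ (@fps_cvg_const R 1)).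
have cvg : fps_cvg_to (fun k => Fps (fun n => (num_bounded k n)%:R : R))
             (Fps (fun n => (num_partitions n)%:R)).
  by move=> n; exists n => k nk /=; rewrite num_bounded_large.
move=> n; have [N HN] := fps_cvg_mul cvg (@euler_prod_cvg R P) n.
by exists N => m /HN <-; rewrite num_bounded_series.
Qed.

End PartitionSeries.

(** * Admissible parts in terms of parity and divisibility *)

Lemma nz_even_residueE s m : ~~ odd s -> (0 < s)%N ->
  nz_even_residue s m = ~~ (odd m || (s %| m)%N).
Proof.
move=> s_even s_gt0.
have sE : (s = 2 * s./2)%N by rewrite mul2n even_halfK.
have odd_mod : odd (m %% s) = odd m.
  by rewrite [in RHS](divn_eq m s) oddD oddM (negbTE s_even) andbF.
have lt_ms := ltn_pmod m s_gt0.
apply/existsP/norP => [[j /andP[j_gt0 /eqP mj]]|[m_even s_ndvd]].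
  have jE : (m %% s = 2 * j)%N by rewrite mj modn_small //; have := ltn_ord j; lia.
  by rewrite -odd_mod /dvdn jE; split; lia.
rewrite -odd_mod in m_even; rewrite /dvdn in s_ndvd.
(* Reduction modulo the even number [s] keeps parity, so the residue is even and half of it is the
   witness. *)
have lt_j : ((m %% s)./2 < s./2)%N by lia.
exists (Ordinal lt_j); rewrite /= -[(2 * _)%N]/(2 * (m %% s)./2)%N.
rewrite [(2 * _)%N](_ : _ = m %% s)%N; last by lia.
by rewrite modn_mod eqxx andbT; lia.
Qed.

(** Cancelling [t] turns a congruence modulo [t * s] into one modulo [s] for the quotient, and
    [2 * r + 1] runs over all odd residues modulo the even number [s]. *)
Lemma odd_multiple_mod s t m : ~~ odd s -> (0 < s)%N -> (0 < t)%N ->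
  [exists r : 'I_s./2, m == t * (2 * r + 1) %[mod t * s]]%N =
  (t %| m)%N && odd (m %/ t).
Proof.
move=> s_even s_gt0 t_gt0.
have sE : (s = 2 * s./2)%N by rewrite mul2n even_halfK.
have odd_mod j : odd (j %% s) = odd j.
  by rewrite [in RHS](divn_eq j s) oddD oddM (negbTE s_even) andbF.
apply/existsP/andP => [[r /eqP mr]|[/dvdnP[j ->]]].
  have tm : (t %| m)%N.
    have : (t %| m %% (t * s))%N by rewrite mr -muln_modr dvdn_mulr.
    by rewrite -(dvdn_addr _ (dvdn_mull (m %/ (t * s)) (dvdn_mulr s (dvdnn t)))) -divn_eq.
  split=> //; case/dvdnP: tm mr => j ->; rewrite mulnK // mulnC -!muln_modr.
  move=> /eqP; rewrite eqn_pmul2l // => /eqP js.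
  by rewrite -odd_mod js odd_mod oddD oddM.
rewrite mulnK // => j_odd; have lt_js := ltn_pmod j s_gt0.
rewrite -odd_mod in j_odd.
have lt_r : ((j %% s)./2 < s./2)%N by lia.
exists (Ordinal lt_r) => /=; rewrite [(_ + 1)%N](_ : _ = j %% s)%N; last by lia.
by rewrite mulnC -!muln_modr modn_mod.
Qed.

Lemma E_partE s t m : ~~ odd s -> (0 < s)%N -> (0 < t)%N ->
  E_part s t m = (odd m || (s %| m)%N) &&
    ~~ ((t %| m)%N && (odd (m %/ t) || (s %| m %/ t)%N)).
Proof.
move=> s_even s_gt0 t_gt0; rewrite /E_part nz_even_residueE // negbK.
rewrite -negb_exists odd_multiple_mod // mod0n -/(dvdn _ _) -negb_or.
congr (_ && ~~ _); have [/dvdnP[j ->]|tm] := boolP (t %| m)%N.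
  by rewrite mulnK // [(j * t)%N]mulnC dvdn_pmul2l // orbC.
by rewrite orbF; apply/negbTE; apply: contra tm => /(dvdn_trans (dvdn_mulr _ (dvdnn _))).
Qed.

Lemma E_part_exponent s t m : ~~ odd s -> (0 < s)%N -> (0 < t)%N ->
    ~~ nz_even_residue s t ->
  ((1 %| m) + (s %| m) + (2 * t %| m) =
   (2 %| m) + (t %| m) + (t * s %| m) + E_part s t m)%N.
Proof.
move=> s_even s_gt0 t_gt0; rewrite nz_even_residueE // negbK => t_res.
rewrite E_partE // dvd1n [(2 %| m)%N]dvdn2.
have s_odd j : (s %| j)%N -> ~~ odd j.
  by case/dvdnP => i ->; rewrite oddM (negbTE s_even) andbF.
have ms := s_odd m.
(* If [t] does not divide [m], neither do [2 * t] and [t * s], and what remains is [1 + [s | m] =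
   [2 | m] + [m odd or s | m]]. *)
have [/dvdnP[j mE]|tm] := boolP (t %| m)%N; last first.
  have ndvd d : (t %| d)%N -> (d %| m)%N = false.
    by move=> td; apply: contraNF tm; apply: dvdn_trans.
  rewrite [(2 * t %| m)%N]ndvd ?dvdn_mull // [(t * s %| m)%N]ndvd ?dvdn_mulr //=.
  by case: (s %| m)%N ms => [/(_ isT)/negbTE ->|_] //; case: (odd m).
have js := s_odd j.
have -> : (2 * t %| m)%N = ~~ odd j by rewrite mE dvdn_pmul2r // dvdn2.
have -> : (t * s %| m)%N = (s %| j)%N by rewrite mE [(t * s)%N]mulnC dvdn_pmul2r.
have -> : (m %/ t = j)%N by rewrite mE mulnK.
(* This is the inclusion of [B] in [A], the only place where the residue condition on [t] enters. *)
have jm : odd j || (s %| j)%N -> odd m || (s %| m)%N.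
  rewrite mE oddM; case/orP => [->|sj]; last by rewrite (dvdn_mulr _ sj) orbT.
  by case/orP: t_res => [->|st] //; rewrite (dvdn_mull _ st) orbT.
by move: ms js jm; case: (odd m); case: (odd j); case: (s %| m)%N;
   case: (s %| j)%N => //= *; intuition.
Qed.

(** * Comparison of the products and passage to the limit *)

Lemma euler_partial_identity (R : comNzRingType) s t N : ~~ odd s ->
    (0 < s)%N -> (0 < t)%N -> ~~ nz_even_residue s t ->
  euler_partial R (dvdn 1) N * euler_partial R (dvdn s) N
    * euler_partial R (dvdn (2 * t)) N =
  euler_partial R (dvdn 2) N * euler_partial R (dvdn t) N
    * euler_partial R (dvdn (t * s)) N * euler_partial R (E_part s t) N.
Proof.
move=> s_even s_gt0 t_gt0 t_res; elim: N => [|N IHN].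
  by rewrite /euler_partial !big_ord0 !mulr1.
rewrite !euler_partialS; set x := 1 - _.
(* Every partial product gains a power of the same factor [x], so only the total exponents need
   comparing. *)
have mulX a b i j : (a * x ^+ i) * (b * x ^+ j) = a * b * x ^+ (i + j).
  by rewrite mulrACA exprD.
by rewrite !mulX IHN E_part_exponent.
Qed.

Theorem theorem14 (s t : nat) (s_even : ~~ odd s) (s_ge4 : (4 <= s)%N)
    (t_ge3 : (3 <= t)%N) (t_res : ~~ nz_even_residue s t) :
  Fps (fun n => (E s t n)%:Z) =
    (qpoch (fpsX int ^+ 2) (fpsX int ^+ 2)
       * qpoch (fpsX int ^+ t) (fpsX int ^+ t)
       * qpoch (fpsX int ^+ (t * s)) (fpsX int ^+ (t * s)))
    / (qpoch (fpsX int) (fpsX int)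
       * qpoch (fpsX int ^+ s) (fpsX int ^+ s)
       * qpoch (fpsX int ^+ (2 * t)) (fpsX int ^+ (2 * t))).
Proof.
have s_gt0 : (0 < s)%N by lia.
have t_gt0 : (0 < t)%N by lia.
have [t2_gt0 ts_gt0] : (0 < 2 * t)%N /\ (0 < t * s)%N by rewrite !muln_gt0 s_gt0 t_gt0.
have := @qpoch_euler_prod int 1 isT; rewrite expr1 => ->.
rewrite !qpoch_euler_prod //.
have cvg (P : pred nat) := @euler_prod_cvg int P.
set D := _ * euler_prod int (dvdn (2 * t)).
set N := _ * euler_prod int (dvdn (t * s)).
have DN : D = N * euler_prod int (E_part s t).
  apply: fps_cvg_unique (fps_cvg_mul (fps_cvg_mul (fps_cvg_mul
    (cvg _) (cvg _)) (cvg _)) (cvg (E_part s t))).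
  move=> n; have [M HM] :=
    fps_cvg_mul (fps_cvg_mul (cvg (dvdn 1)) (cvg (dvdn s))) (cvg (dvdn (2 * t))) n.
  by exists M => m /HM <-; rewrite euler_partial_identity.
(* A power series is invertible as soon as its constant coefficient is, and here that coefficient is
   1. *)
have D_unit : D \is a GRing.unit.
  have D0 P : fcoef (euler_prod int P) 0 = 1.
    by rewrite /= /euler_partial big_ord0.
  rewrite !unitrM; apply/andP; split; last by rewrite unfold_in /= /fps_unit D0.
  by apply/andP; split; rewrite unfold_in /= /fps_unit D0.
(* Once [D] is cleared and replaced by [DN], the common factor [N] leaves Euler's identity for the
   admissible parts. *)
apply: (canRL (mulrK D_unit)); rewrite DN mulrCA -[RHS]mulr1; congr (_ * _).
rewrite -[RHS](num_partitions_series (E_part s t)); congr (_ * _).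
by apply/fpsP => n /=; rewrite natz.
Qed.
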